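(* Let $P:\mathbb{R}^n\to\mathbb{R}$ be a homogeneous real polynomial of degree $k$ that is symmetric and hyperbolic with respect to $\mathbf{1}=(1,\dots,1)$, with hyperbolicity cone $\Gamma(P)$ with respect to $\mathbf{1}$. Let $A$ be an $n\times n$ Hermitian matrix partitioned as $$A=\begin{pmatrix} A_{11} & A_{12} \\ A_{21} & A_{22} \end{pmatrix}$$ with square diagonal blocks $A_{11},A_{22}$. If $\lambda(A)\in\Gamma(P)$, then $$(\lambda(A_{11}),\lambda(A_{22}))\in\Gamma(P)\quad\text{and}\quad P(\lambda(A_{11}),\lambda(A_{22}))\ge P(\lambda(A)).$$
   Context: $\lambda(M)$ denotes the list of eigenvalues (with multiplicity) of a Hermitian matrix $M$; $(\lambda(A_{11}),\lambda(A_{22}))\in\mathbb{R}^n$ is the concatenation, i.e. the eigenvalue list of $A_{11}\oplus A_{22}$. The order is immaterial because $P$ is symmetric. A polynomial $P:\mathbb{R}^n\to\mathbb{R}$ is symmetric if $P(\sigma x)=P(x)$ for every permutation $\sigma$ of the coordinates and every $x\in\mathbb{R}^n$. A homogeneous real polynomial $P$ of degree $k$ on $\mathbb{R}^n$ is hyperbolic with respect to $a\in\mathbb{R}^n$ if $P(a)>0$ and, for every $x\in\mathbb{R}^n$, the univariate polynomial $t\mapsto P(ta+x)$ has only real zeros. In that case $P(ta+x)=P(a)\prod_{i=1}^k(t+\lambda_i(P;a,x))$ with real numbers $\lambda_i(P;a,x)$. The hyperbolicity cone is $\Gamma(P;a)=\{x\in\mathbb{R}^n:\lambda_i(P;a,x)>0\text{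 for all }i=1,\dots,k\}$, and $\Gamma(P):=\Gamma(P;\mathbf{1})$. *)

(* Defs.v *)
From mathcomp Require Import all_boot all_order all_algebra.
From mathcomp Require Import perm reals complex mpoly.

Set Implicit Arguments.
Unset Strict Implicit.
Unset Printing Implicit Defensive.

Import Order.TTheory GRing.Theory Num.Theory.
Local Open Scope ring_scope.

Definition symmetric_fun (R : realType) (n : nat) (P : {mpoly R[n]}) : Prop :=
  forall (s : 'S_n) (x : 'rV[R]_n), P.@[(col_perm s x) 0] = P.@[x 0].

(* The univariate polynomial t |-> P (t a + x). *)
Definition line_poly (R : realType) (n : nat) (P : {mpoly R[n]})
    (a x : 'rV[R]_n) : {poly R} :=
  mmap polyC (fun i => (a 0 i) *: 'X + (x 0 i)%:P) P.

Lemma horner_line_poly (R : realType) (n : nat) (P : {mpoly R[n]})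
    (a x : 'rV[R]_n) (t : R) :
  (line_poly P a x).[t] = P.@[(t *: a + x) 0].
Proof.
rewrite /line_poly /mmap mevalE horner_sum; apply: eq_bigr => m _.
rewrite hornerM hornerC /mmap1 horner_prod; congr (_ * _).
by apply: eq_bigr => i _; rewrite horner_exp !hornerE !mxE mulrC.
Qed.

(* The zeros of a real polynomial are taken in the complex field R[i]. *)
Definition only_real_zeros (R : realType) (p : {poly R}) : Prop :=
  forall z : R[i], root (map_poly (real_complex R) p) z -> complex.Im z = 0.

Definition hyperbolic (R : realType) (n : nat) (P : {mpoly R[n]})
    (a : 'rV[R]_n) : Prop :=
  0 < P.@[a 0] /\ forall x : 'rV[R]_n, only_real_zeros (line_poly P a x).

(* [lam] lists the lambda_i (P; a, x), with multiplicity. *)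
Definition hyp_eigenvalues (R : realType) (n k : nat) (P : {mpoly R[n]})
    (a x : 'rV[R]_n) (lam : 'I_k -> R) : Prop :=
  line_poly P a x = P.@[a 0] *: \prod_(i < k) ('X + (lam i)%:P).

(* When P is k-homogeneous and hyperbolic with respect to a, the list lam
   exists and is unique up to order, see [hyp_eigenvalues_exist] and
   [hyp_eigenvalues_uniq]. *)
Definition hyp_cone (R : realType) (n k : nat) (P : {mpoly R[n]})
    (a x : 'rV[R]_n) : Prop :=
  exists lam : 'I_k -> R,
    hyp_eigenvalues P a x lam /\ forall i : 'I_k, 0 < lam i.

Definition ones (R : realType) (n : nat) : 'rV[R]_n := const_mx 1.

(* [spectral_diag M] lists the eigenvalues of a normal matrix M; they are real
   when M is Hermitian, see [char_poly_eigvals]. *)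
Definition eigvals (R : realType) (n : nat) (M : 'M[R[i]]_n) : 'rV[R]_n :=
  map_mx (@complex.Re R) (spectral_diag M).

Lemma char_poly_eigvals (R : realType) (n : nat) (M : 'M[R[i]]_n) :
  M \is hermsymmx ->
  char_poly M = \prod_(i < n) ('X - ((eigvals M 0 i)%:C)%C%:P).
Proof.
move=> hM; pose D := diag_mx (spectral_diag M).
have /mxOverP realD := hermitian_spectral_diag_real hM.
have Uu := spectral_unit M; set U := spectralmx M in Uu.
have eM : M = invmx U *m D *m U.
  by apply/orthomx_spectralP; apply: hermitian_normalmx.
have -> : char_poly M = char_poly D.
  rewrite /char_poly.
  have -> : char_poly_mx M =
      map_mx polyC (invmx U) *m char_poly_mx D *m map_mx polyC U.
    rewrite /char_poly_mx mulmxBr mulmxBl -!map_mxM /= -eM; congr (_ - _).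
    by rewrite scalar_mxC -mulmxA -map_mxM /= mulVmx// map_mx1 mulmx1.
  rewrite !det_mulmx mulrAC -det_mulmx -map_mxM /= mulVmx//.
  by rewrite map_mx1 det1 mul1r.
rewrite char_poly_trig ?diag_mx_is_trig//.
apply: eq_bigr => i _; rewrite !mxE eqxx mulr1n.
have := realD 0 i; case: (spectral_diag M 0 i) => [u v].
by move=> /RIm_real /= [->].
Qed.

Lemma hyp_eigenvalues_uniq (R : realType) (n k : nat) (P : {mpoly R[n]})
    (a x : 'rV[R]_n) (lam mu : 'I_k -> R) :
  P.@[a 0] != 0 -> hyp_eigenvalues P a x lam -> hyp_eigenvalues P a x mu ->
  perm_eq (codom lam) (codom mu).
Proof.
move=> Pa; rewrite /hyp_eigenvalues => -> /(scalerI Pa) e.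
apply: (perm_map_inj (@oppr_inj R)); apply: prod_XsubC_eq.
rewrite big_map [in RHS]big_map !big_image /=.
have E (f : 'I_k -> R) :
    \prod_i ('X - (- f i)%:P) = \prod_(i < k) ('X + (f i)%:P).
  by apply: eq_bigr => i _; rewrite polyCN opprK.
by rewrite !E.
Qed.

Lemma top_coefM (R : nzRingType) (p q : {poly R}) (c d : nat) :
  (size p <= c.+1)%N -> (size q <= d.+1)%N ->
  (p * q)`_(c + d) = p`_c * q`_d.
Proof.
move=> sp sq; have hc : (c < (c + d).+1)%N by rewrite ltnS leq_addr.
rewrite coefM (bigD1 (Ordinal hc)) //= addKn big1 ?addr0// => j.
rewrite -val_eqE /= neq_ltn => /orP[lt|lt]; last first.
  by rewrite [p`_j]nth_default ?mul0r// (leq_trans sp).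
rewrite [q`__]nth_default ?mulr0// (leq_trans sq)//.
by rewrite ltn_subRL ltn_add2r.
Qed.

Lemma line_poly_top (R : realType) (n k : nat) (P : {mpoly R[n]})
    (a x : 'rV[R]_n) : P \is k.-homog ->
  (size (line_poly P a x) <= k.+1)%N /\ (line_poly P a x)`_k = P.@[a 0].
Proof.
move=> /dhomogP hP.
pose top (p : {poly R}) d c := (size p <= d.+1)%N /\ p`_d = c.
have topM p q d e c c' : top p d c -> top q e c' -> top (p * q) (d + e)%N (c * c').
  move=> [sp cp] [sq cq]; split; last by rewrite top_coefM// cp cq.
  apply: leq_trans (size_polyMleq _ _) _.
  by have := leq_add sp sq; rewrite addnS addSn; case: (_ + _)%N.
have top1 : top 1 0%N 1 by split; rewrite ?size_poly1 ?coef1.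
have topE i m : top (((a 0 i) *: 'X + (x 0 i)%:P) ^+ m) m (a 0 i ^+ m).
  elim: m => [//|m IH]; rewrite !exprS -(add1n m); apply: topM => //; split.
    apply: leq_trans (size_polyD _ _) _; rewrite geq_max.
    rewrite (leq_trans (size_scale_leq _ _)) ?size_polyX//.
    by rewrite (leq_trans (size_polyC_leq1 _)).
  by rewrite coefD coefZ coefX coefC /= mulr1 addr0.
have topm (m : 'X_{1..n}) : top
    (mmap1 (fun i => (a 0 i) *: 'X + (x 0 i)%:P) m) (mdeg m) (mmap1 (a 0) m).
  rewrite /mmap1 mdegE.
  by elim/big_rec3: _ => [//|i u d v _ IH]; apply: topM.
have topP : top (line_poly P a x) k (P.@[a 0]); last by case: topP.
rewrite /line_poly /meval /mmap big_seq_cond [in X in top _ _ X]big_seq_cond.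
elim/big_rec2: _ => [|m u v]; first by split; rewrite ?size_poly0 ?coef0.
rewrite andbT => /hP dm [su cu].
have [] := topm m; rewrite (dm : mdeg m = k) => sm cm.
split; last by rewrite coefD coefCM cm cu.
apply: leq_trans (size_polyD _ _) _; rewrite geq_max su andbT mul_polyC.
by rewrite (leq_trans (size_scale_leq _ _)).
Qed.

Lemma hyp_eigenvalues_exist (R : realType) (n k : nat) (P : {mpoly R[n]})
    (a x : 'rV[R]_n) :
  P \is k.-homog -> hyperbolic P a ->
  exists lam : 'I_k -> R, hyp_eigenvalues P a x lam.
Proof.
move=> hP [Pa /(_ x) hr]; have [sp cp] := line_poly_top a x hP.
rewrite /hyp_eigenvalues; set p := line_poly P a x in hr sp cp *.
have sz : size p = k.+1.
  by apply/anti_leq; rewrite sp /= ltnNge; apply/negP => h;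
    move: cp Pa; rewrite nth_default// => <-; rewrite ltxx.
have lc : lead_coef p = P.@[a 0] by rewrite lead_coefE sz.
have [r er] := closed_field_poly_normal (map_poly (real_complex R) p).
rewrite lead_coef_map lc in er.
have cn0 : real_complex R P.@[a 0] != 0 by rewrite fmorph_eq0 gt_eqF.
have szr : size r = k.
  have := congr1 (fun q : {poly _} => size q) er.
  by rewrite size_map_poly sz size_scale// size_prod_XsubC => -[].
have rr z : z \in r -> z = real_complex R (complex.Re z).
  move=> zr; have := hr z; rewrite er rootZ// root_prod_XsubC => /(_ zr).
  by case: (z) => u v /= ->.
exists (fun i => - complex.Re r`_i).
apply: (map_poly_inj (real_complex R)); rewrite er map_polyZ rmorph_prod /=.
congr (_ *: _); rewrite (big_nth 0) szr big_mkord; apply: eq_bigr => i _.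
rewrite rmorphD /= map_polyX map_polyC /= [in LHS](rr r`_i) ?mem_nth ?szr//.
by rewrite -polyCN -rmorphN.
Qed.

(* Main.v *)
Require Import Defs.
From mathcomp Require Import all_boot all_order all_algebra.
From mathcomp Require Import perm reals complex mpoly.
From mathcomp Require Import boolp classical_sets.
From mathcomp Require Import ring lra.

Set Implicit Arguments.
Unset Strict Implicit.
Unset Printing Implicit Defensive.

Import Order.TTheory GRing.Theory Num.Theory.
Local Open Scope ring_scope.

Import Normc.

(** Write [lambda] for the eigenvalue list of [A] and [mu] for the joined
    eigenvalue lists of the two diagonal blocks.  Conjugating [A] by the
    block-diagonal unitary matrix that diagonalizes both blocks turns [mu] into
    the diagonal of [W D W^*], where [D] is the diagonal matrix of [lambda] and
    [W] is unitary.  Hence [mu = S lambda] with [S] doubly stochastic, its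
    entries being the squared moduli of those of [W]
    ([block_eigvals_doubly_stochastic]).

    By the argument of Hardy, Littlewood and Polya, [mu] is then reached from a
    permutation of [lambda] by finitely many transfers between two coordinates,
    [x |-> (1 - s) x + s (x with i and j exchanged)] with [0 <= s <= 1]
    ([transfer_doubly_stochastic]).  So it is enough that a transfer keeps the
    point in the cone and does not decrease [P] ([transfer_increase]).

    Let [m] be the midpoint of [x] and its exchanged copy, and [d] half their
    difference.  The transfer moves along the line [m + t d] from [t = 1] to
    some [t] in [[-1, 1]], and by symmetry [q t = P (m + t d)] is even.
    Garding's theory provides two facts: the cone is convex ([hyp_cone_convex]),
    so [q] is positive on [[-1, 1]]; and [q] has only real zeros [w]
    ([line_real_zeros]).  Then
    [q t ^ 2 = q t * q (- t) = c ^ 2 * prod (w ^ 2 - t ^ 2)]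
    with every [w ^ 2 > 1], and this is at least [q 1 ^ 2]
    ([even_line_increase]).

    Both facts of Garding's theory follow from the single statement that
    [P (v + i (h e + r a))] does not vanish for real [v], [h > 0], [r >= 0] and
    [a] a sum of elements of the cone ([stable_dirD]).  Adding one more element
    [y] of the cone to [a] amounts to showing that the polynomial
    [z |-> P (v + i (h e + r a) + z y)] has no zero in the closed upper
    half-plane.  Shrinking [v] and [r] to [0] linearly, no zero can cross the
    real axis, by the statement for [a], while at the end of the deformation the
    zeros are [- i h / lambda_j (P; e, y)], in the lower half-plane
    ([upper_roots_homotopy]). *)

(** * Lipschitz dependence of polynomial values on a parameter *)

Section LipschitzGrowth.

Variable R : realType.
Local Notation C := R[i].
Local Notation rc := (real_complex R).

Lemma normc_ge0 (z : C) : 0 <= normc z :> R.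
Proof. by case: z => x y; rewrite sqrtr_ge0. Qed.

Lemma normc_real (x : R) : normc (rc x) = `|x|.
Proof. by rewrite /normc /= expr0n addr0 sqrtr_sqr. Qed.

Lemma normcD_le (x y : C) : normc (x + y) <= normc x + normc y.
Proof. exact: le_normcD. Qed.

(** [f t] behaves like a polynomial of degree at most [d] in [z] whose
    coefficients are Lipschitz in [t]; the bounds hold over the whole plane, to
    control zeros of large modulus as well. *)
Definition lip_growth (d : nat) (f : R -> C -> C) : Prop :=
  exists2 M : R, 0 <= M & forall (z : C) (s t : R), 0 <= s <= 1 -> 0 <= t <= 1 ->
    normc (f t z) <= M * (1 + normc z) ^+ d /\
    normc (f t z - f s z) <= M * `|t - s| * (1 + normc z) ^+ d.

Let z1k (z : C) d : 0 <= (1 + normc z) ^+ d :> R.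
Proof. by rewrite exprn_ge0// addr_ge0 ?normc_ge0. Qed.

Lemma lip_growth_ext d f g : (forall t z, f t z = g t z) ->
  lip_growth d f -> lip_growth d g.
Proof.
move=> fg [M M0 h]; exists M => // z s t hs ht; rewrite -!fg.
exact: h.
Qed.

Lemma lip_growthC w : lip_growth 0 (fun _ _ => w).
Proof.
exists (normc w); first exact: normc_ge0.
move=> z s t _ _; rewrite expr0 !mulr1; split=> //.
by rewrite subrr normc0 mulr_ge0 ?normc_ge0.
Qed.

Lemma lip_growth0 d : lip_growth d (fun _ _ => 0).
Proof. by exists 0 => // z s t _ _; rewrite subrr normc0 !mul0r. Qed.

Lemma lip_growth_affine (u v w : C) :
  lip_growth 1 (fun t z => z * u + (rc t * v + w)).
Proof.
exists (normc u + normc v + normc w); first by rewrite !addr_ge0 ?normc_ge0.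
move=> z s t _ /andP[t0 t1]; rewrite !expr1.
have [zu zv zw zz] := And4 (normc_ge0 u) (normc_ge0 v) (normc_ge0 w) (normc_ge0 z).
split.
  apply: le_trans (normcD_le _ _) _.
  apply: le_trans (lerD (lexx _) (normcD_le _ _)) _.
  rewrite !normcM normc_real ger0_norm//.
  have : t * normc v <= normc v by rewrite ler_piMl.
  by have := mulr_ge0 zz zv; have := mulr_ge0 zz zw; lra.
have -> : z * u + (rc t * v + w) - (z * u + (rc s * v + w)) = rc (t - s) * v.
  by rewrite rmorphB /=; ring.
rewrite normcM normc_real mulrAC [leRHS]mulrC ler_wpM2l//.
by have := mulr_ge0 zu zz; have := mulr_ge0 zv zz; have := mulr_ge0 zw zz; lra.
Qed.

Lemma lip_growthM d e f g : lip_growth d f -> lip_growth e g ->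
  lip_growth (d + e) (fun t z => f t z * g t z).
Proof.
move=> [M M0 Mf] [N N0 Ng]; exists (M * N *+ 2).
  by rewrite mulrn_wge0 ?mulr_ge0.
move=> z s t hs ht; have [f1 f2] := Mf z s t hs ht.
have [g1 g2] := Ng z s t hs ht; have [f1' _] := Mf z s s hs hs.
rewrite exprD normcM; split.
  apply: le_trans (ler_pM _ _ f1 g1) _; rewrite ?normc_ge0//.
  have := mulr_ge0 (mulr_ge0 M0 (z1k z d)) (mulr_ge0 N0 (z1k z e)).
  by rewrite mulr2n; lra.
have -> : f t z * g t z - f s z * g s z =
    (f t z - f s z) * g t z + f s z * (g t z - g s z) by ring.
apply: le_trans (normcD_le _ _) _; rewrite !normcM.
apply: le_trans (lerD (ler_pM _ _ f2 g1) (ler_pM _ _ f1' g2)) _; rewrite ?normc_ge0//.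
by rewrite le_eqVlt; apply/orP; left; apply/eqP; ring.
Qed.

Lemma lip_growthD d f g : lip_growth d f -> lip_growth d g ->
  lip_growth d (fun t z => f t z + g t z).
Proof.
move=> [M M0 Mf] [N N0 Ng]; exists (M + N); first by rewrite addr_ge0.
move=> z s t hs ht; have [f1 f2] := Mf z s t hs ht.
have [g1 g2] := Ng z s t hs ht.
split; first by rewrite mulrDl (le_trans (normcD_le _ _))// lerD.
by rewrite opprD addrACA !mulrDl (le_trans (normcD_le _ _))// lerD.
Qed.

Lemma lip_growthX d f m : lip_growth d f -> lip_growth (m * d) (fun t z => f t z ^+ m).
Proof.
move=> hf; elim: m => [|m IH]; first exact: lip_growthC.
apply: lip_growth_ext (lip_growthM hf IH) => t z; by rewrite exprS.
Qed.

Lemma lip_growth_prod (I : Type) (l : seq I) (d : I -> nat) (f : I -> R -> C -> C) :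
  (forall i, lip_growth (d i) (f i)) ->
  lip_growth (\sum_(i <- l) d i) (fun t z => \prod_(i <- l) f i t z).
Proof.
move=> hf; elim: l => [|i l IH].
  rewrite big_nil; apply: lip_growth_ext (lip_growthC 1) => t z.
  by rewrite big_nil.
rewrite big_cons; apply: lip_growth_ext (lip_growthM (hf i) IH) => t z.
by rewrite big_cons.
Qed.

Lemma lip_growth_sum (I : eqType) (l : seq I) d (f : I -> R -> C -> C) :
  {in l, forall i, lip_growth d (f i)} ->
  lip_growth d (fun t z => \sum_(i <- l) f i t z).
Proof.
elim: l => [|i l IH] hf.
  by apply: lip_growth_ext (lip_growth0 d) => t z; rewrite big_nil.
apply: (@lip_growth_ext _ (fun t z => f i t z + \sum_(j <- l) f j t z)).
  by move=> t z; rewrite big_cons.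
apply: lip_growthD; first by apply: hf; rewrite mem_head.
by apply: IH => j jl; apply: hf; rewrite in_cons jl orbT.
Qed.

End LipschitzGrowth.

(** * Values of a real homogeneous polynomial at complex points *)

Section ComplexPoints.

Variables (R : realType) (n k : nat) (P : {mpoly R[n]}).
Local Notation C := R[i].
Local Notation rc := (real_complex R).
Local Notation toC := (map_mx rc).

Definition evalC (u : 'rV[C]_n) : C := mmap rc (u 0) P.

Lemma evalC_real (x : 'rV[R]_n) : evalC (toC x) = rc P.@[x 0].
Proof.
rewrite /evalC /mmap mevalE rmorph_sum; apply: eq_bigr => m _.
rewrite rmorphM /= /mmap1 rmorph_prod; congr (_ * _).
by apply: eq_bigr => i _; rewrite mxE rmorphXn.
Qed.

Lemma evalC_line (a x : 'rV[R]_n) (z : C) :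
  (map_poly rc (line_poly P a x)).[z] = evalC (z *: toC a + toC x).
Proof.
rewrite /line_poly /evalC /mmap rmorph_sum horner_sum; apply: eq_bigr => m _.
rewrite rmorphM hornerM /= map_polyC hornerC; congr (_ * _).
rewrite /mmap1 rmorph_prod horner_prod; apply: eq_bigr => i _.
rewrite rmorphXn horner_exp /= rmorphD /= map_polyZ /= map_polyX map_polyC.
by rewrite !hornerE /= !mxE mulrC.
Qed.

Hypothesis homP : P \is k.-homog.

Lemma evalCZ (z : C) (u : 'rV[C]_n) : evalC (z *: u) = z ^+ k * evalC u.
Proof.
move/dhomogP: homP => hP.
rewrite /evalC /mmap big_distrr /= big_seq [RHS]big_seq; apply: eq_bigr => m /hP /= <-.
rewrite mulrCA; congr (_ * _); rewrite /mmap1 mdegE.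
elim/big_rec3: _ => [|i d q p _ ->]; first by rewrite mulr1.
by rewrite mxE exprMn exprD; ring.
Qed.

(** The leading coefficient of [z |-> P (z a + u)] is [P a], whatever the base
    point [u]: when [P a] is not [0], the degree of this polynomial does not
    drop as [u] varies. *)
Lemma evalC_factor (a u : 'rV[C]_n) : evalC a != 0 ->
  exists2 r : seq C, size r = k &
    forall z, evalC (z *: a + u) = evalC a * \prod_(w <- r) (z - w).
Proof.
move/dhomogP: homP => hP a0.
pose L : {poly C} := mmap (polyC \o rc) (fun i => (a 0 i) *: 'X + (u 0 i)%:P) P.
have evL z : L.[z] = evalC (z *: a + u).
  rewrite /L /evalC /mmap horner_sum; apply: eq_bigr => m _.
  rewrite hornerM hornerC /mmap1 horner_prod; congr (_ * _).
  by apply: eq_bigr => i _; rewrite horner_exp !hornerE !mxE mulrC.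
pose top (p : {poly C}) d c := (size p <= d.+1)%N /\ p`_d = c.
have topM p q d e c c' : top p d c -> top q e c' -> top (p * q) (d + e)%N (c * c').
  move=> [sp cp] [sq cq]; split; last by rewrite top_coefM// cp cq.
  apply: leq_trans (size_polyMleq _ _) _.
  by have := leq_add sp sq; rewrite addnS addSn; case: (_ + _)%N.
have topX i m : top (((a 0 i) *: 'X + (u 0 i)%:P) ^+ m) m (a 0 i ^+ m).
  elim: m => [|m IH]; first by split; rewrite ?size_poly1 ?coef1.
  rewrite !exprS -(add1n m); apply: topM => //; split.
    rewrite (leq_trans (size_polyD _ _))// geq_max size_polyC.
    rewrite (leq_trans (size_scale_leq _ _)) ?size_polyX//.
    by case: (_ == _).
  by rewrite coefD coefZ coefX coefC /= mulr1 addr0.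
have [sL cL] : top L k (evalC a).
  rewrite /L /evalC /mmap big_seq [X in top _ _ X]big_seq.
  elim/big_rec2: _ => [|m c p /hP /= <- [sp cp]].
    by split; rewrite ?size_poly0 ?coef0.
  have [sm cm] : top (mmap1 (fun i => (a 0 i) *: 'X + (u 0 i)%:P) m) (mdeg m)
      (mmap1 (a 0) m).
    rewrite /mmap1 mdegE; elim/big_rec3: _ => [|i b d q _ IH]; last exact: topM.
    by split; rewrite ?size_poly1 ?coef1.
  split; last by rewrite coefD coefCM cm cp.
  rewrite (leq_trans (size_polyD _ _))// geq_max sp andbT mul_polyC.
  by rewrite (leq_trans (size_scale_leq _ _)).
have szL : size L = k.+1.
  apply/anti_leq; rewrite sL ltnNge; apply: contra a0 => h.
  by rewrite -cL nth_default.
have lcL : lead_coef L = evalC a by rewrite lead_coefE szL.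
have [r er] := closed_field_poly_normal L; rewrite lcL in er.
exists r => [|z].
  by move: szL; rewrite er size_scale// size_prod_XsubC => -[].
rewrite -evL er hornerZ horner_prod; congr (_ * _).
by apply: eq_bigr => w _; rewrite !hornerE.
Qed.

Lemma evalC_lip_growth (a b c : 'rV[C]_n) :
  lip_growth k (fun t z => evalC (z *: a + (rc t *: b + c))).
Proof.
move/dhomogP: homP => hP; apply: lip_growth_sum => m /hP /= <-.
rewrite -[mdeg m]add0n; apply: lip_growthM; first exact: lip_growthC.
rewrite mdegE; apply: lip_growth_prod => i; rewrite -{1}[m i]muln1.
apply: lip_growthX.
apply: lip_growth_ext (lip_growth_affine (a 0 i) (b 0 i) (c 0 i)) => t z.
by rewrite !mxE.
Qed.

End ComplexPoints.

(** * Zeros staying out of the upper half-plane along a deformation *)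

(** Connectedness of [[0, 1]]: [Q] and its complement are both relatively
    open. *)
Lemma unit_interval_connected (R : realType) (Q : R -> Prop) :
  (forall s, 0 <= s <= 1 -> Q s -> exists2 d, 0 < d &
     forall t, 0 <= t <= 1 -> `|t - s| < d -> Q t) ->
  (forall s, 0 <= s <= 1 -> ~ Q s -> exists2 d, 0 < d &
     forall t, 0 <= t <= 1 -> `|t - s| < d -> ~ Q t) ->
  Q 0 -> Q 1.
Proof.
move=> openQ closedQ Q0.
(* the points up to which [Q] holds without interruption *)
pose E : set R := fun s => 0 <= s <= 1 /\ forall u, 0 <= u <= s -> Q u.
have E0 : E 0.
  split=> [|u /andP[u0 u0']]; first by rewrite lexx ler01.
  by have -> : u = 0 by apply/le_anti; rewrite u0 u0'.
have supE : has_sup E.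
  by split; [exists 0 | exists 1 => s [/andP[]]].
pose s := sup E.
have leEs u : E u -> u <= s by apply: sup_upper_bound.
have s0 : 0 <= s by apply: leEs.
have s1 : s <= 1 by apply: sup_le_ub => [|u [/andP[]]]; first by exists 0.
have s01 : 0 <= s <= 1 by rewrite s0.
have Qlt u : 0 <= u < s -> Q u.
  move=> /andP[u0 us]; have [|v [_ Ev]] := @sup_adherent _ E (s - u) _ supE.
    by rewrite subr_gt0.
  by rewrite -/s subKr => uv; apply: Ev; rewrite u0 ltW.
have Qs : Q s.
  apply: contrapT => nQs; have [d d0 hd] := closedQ s s01 nQs.
  have [v Ev vs] := sup_adherent d0 supE; have [/andP[v0 v1] Qv] := Ev.
  apply: (hd v); rewrite ?v0 ?v1 //; last by apply: Qv; rewrite v0 lexx.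
  by rewrite ltr_norml; have := leEs v Ev; rewrite -/s in vs *; lra.
have [d d0 hd] := openQ s s01 Qs.
have Em : E (Num.min 1 (s + d / 2)).
  split; first by rewrite ge_min lexx le_min ler01 /= andbT; lra.
  move=> u /andP[u0]; rewrite le_min => /andP[u1 ud].
  case: (ltP u s) => us; first by apply: Qlt; rewrite u0.
  by apply: hd; rewrite ?u0 // ltr_norml; lra.
have := leEs _ Em; rewrite ge_min => /orP[s1'|]; last by lra.
by have <- : s = 1 by apply/le_anti; rewrite s1 s1'.
Qed.

Section RootHomotopy.

Variable R : realType.
Local Notation C := R[i].
Local Notation rc := (real_complex R).
Local Notation Im := (@complex.Im R).

Lemma normc_ge_Im (z : C) : Im z <= normc z.
Proof.
case: z => x y /=; apply: le_trans (ler_norm _) _.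
by rewrite -sqrtr_sqr ler_wsqrtr// lerDr sqr_ge0.
Qed.

Lemma normc_prod_ge (r : seq C) (z : C) (b : R) : 0 <= b ->
  {in r, forall w, b <= normc (z - w)} ->
  b ^+ size r <= normc (\prod_(w <- r) (z - w)).
Proof.
move=> b0; elim: r => [|w r IH] hr; first by rewrite big_nil normc1.
rewrite big_cons normcM exprS ler_pM// ?exprn_ge0//.
  by apply: hr; rewrite mem_head.
by apply: IH => v vr; apply: hr; rewrite in_cons vr orbT.
Qed.

(** The factor [1 + normc z] makes the bound effective for large [z], where it
    is compared with the growth allowed by [lip_growth]. *)
Lemma upper_half_separation (r : seq C) : {in r, forall w, Im w < 0} ->
  exists2 b : R, 0 < b &
    {in r, forall w z, 0 <= Im z -> b * (1 + normc z) <= normc (z - w)}.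
Proof.
elim: r => [|w r IH] hr; first by exists 1.
have [|b b0 hb] := IH; first by move=> v vr; apply: hr; rewrite in_cons vr orbT.
have w0 : Im w < 0 by apply: hr; rewrite mem_head.
pose y := - Im w; have y0 : 0 < y by rewrite oppr_gt0.
have den : 0 < 1 + normc w + y by rewrite addr_gt0// ltr_wpDr ?normc_ge0.
(* From [y <= |z - w|] and [|z| <= |z - w| + |w|] one gets
   [y (1 + |z|) <= |z - w| (1 + |w| + y)]. *)
pose c := y / (1 + normc w + y); have c0 : 0 < c by rewrite divr_gt0.
have hc z : 0 <= Im z -> c * (1 + normc z) <= normc (z - w).
  move=> z0; have yz : y <= normc (z - w).
    apply: le_trans (normc_ge_Im _); rewrite /y raddfB /=.
    by rewrite lerBrDr addNr.
  have zw : normc z <= normc (z - w) + normc w.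
    by rewrite -{1}[z](subrK w) normcD_le.
  rewrite /c mulrAC ler_pdivrMr//.
  have := ler_wpM2r (normc_ge0 w) yz; have := ler_wpM2l (ltW y0) zw.
  by lra.
exists (Num.min b c); first by rewrite lt_min b0.
have z1 (z : C) : 0 <= 1 + normc z by rewrite addr_ge0 ?normc_ge0.
move=> v; rewrite in_cons => /orP[/eqP->|vr] z z0.
  by apply: le_trans (hc z z0); rewrite ler_wpM2r// ge_min lexx orbT.
by apply: le_trans (hb v vr z z0); rewrite ler_wpM2r// ge_min lexx.
Qed.

(** The parameters whose zeros all lie in the lower half-plane form an open set:
    there [|F s z|] is at least a constant times [(1 + |z|) ^ k] in the upper
    half-plane, more than a small change of parameter can cancel.  So do the
    other parameters: a zero [z] in the closed upper half-plane lies in the open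
    one, and if all zeros [w] of a nearby [F t] were in the lower half-plane,
    then [|z - w| >= Im z] would keep [F t z] away from [0]. *)
Lemma upper_roots_homotopy (F : R -> C -> C) (k : nat) (c : C) :
  c != 0 ->
  (forall t, exists2 r : seq C, size r = k &
     forall z, F t z = c * \prod_(w <- r) (z - w)) ->
  lip_growth k F ->
  (forall t x, 0 <= t <= 1 -> F t (rc x) != 0) ->
  (forall z, 0 <= Im z -> F 0 z != 0) ->
  forall z, 0 <= Im z -> F 1 z != 0.
Proof.
move=> c0 factF [M M0 lipF] realF.
have nc0 : 0 < normc c.
  by rewrite lt_neqAle normc_ge0 andbT eq_sym; apply: contra c0 => /eqP/eq0_normc->.
have z1 (z : C) : 0 < 1 + normc z by rewrite ltr_wpDr ?normc_ge0.
pose good t := forall z, 0 <= Im z -> F t z != 0.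
have low_roots t r : good t -> (forall z, F t z = c * \prod_(w <- r) (z - w)) ->
    {in r, forall w, Im w < 0}.
  move=> gt er w wr; rewrite ltNge; apply/negP => /gt; rewrite er.
  by rewrite (big_rem w)//= subrr mul0r mulr0 eqxx.
apply: (@unit_interval_connected R good) => s hs gs.
- have [r szr er] := factF s.
  have [b b0 hb] := upper_half_separation (low_roots _ _ gs er).
  exists (normc c * b ^+ k / (M + 1)).
    by rewrite divr_gt0 ?mulr_gt0 ?exprn_gt0// ltr_wpDl.
  move=> t ht; rewrite ltr_pdivlMr ?ltr_wpDl// => tsd z z0.
  apply/negP => /eqP Ftz.
  have [_] := lipF z t s ht hs; rewrite Ftz subr0 er normcM leNgt => /negP; apply.
  have lo : (b * (1 + normc z)) ^+ k <= normc (\prod_(w <- r) (z - w)).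
    by rewrite -szr normc_prod_ge ?mulr_ge0 ?ltW// => w wr; apply: hb.
  apply: lt_le_trans (ler_wpM2l (ltW nc0) lo).
  rewrite exprMn mulrA ltr_pM2r ?exprn_gt0//.
  apply: le_lt_trans tsd; rewrite distrC mulrC ler_wpM2l// lerDl//.
- have /existsNP[z /not_implyP[z0 /negP/negPn/eqP Fsz]] := gs.
  have zpos : 0 < Im z.
    rewrite lt_neqAle z0 andbT; apply/eqP => Iz.
    have := realF s (complex.Re z) hs.
    have -> : rc (complex.Re z) = z by case: (z) Iz => u v /= <-.
    by rewrite Fsz eqxx.
  pose N := M * (1 + normc z) ^+ k; have N0 : 0 <= N.
    by rewrite mulr_ge0 ?exprn_ge0// ltW.
  exists (normc c * Im z ^+ k / (N + 1)).
    by rewrite divr_gt0 ?mulr_gt0 ?exprn_gt0// ltr_wpDl.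
  move=> t ht; rewrite ltr_pdivlMr ?ltr_wpDl// => tsd gt.
  have [r szr er] := factF t; have low := low_roots _ _ gt er.
  have [_] := lipF z s t hs ht; rewrite Fsz subr0 er normcM leNgt => /negP; apply.
  have lo : Im z ^+ k <= normc (\prod_(w <- r) (z - w)).
    rewrite -szr normc_prod_ge// => w /low w0.
    apply: le_trans (normc_ge_Im _); rewrite raddfB /=.
    by rewrite lerDl oppr_ge0 ltW.
  apply: lt_le_trans (ler_wpM2l (ltW nc0) lo).
  by apply: le_lt_trans tsd; rewrite mulrAC -/N mulrC ler_wpM2l// lerDl.
Qed.

End RootHomotopy.

(** * Garding's theory of the hyperbolicity cone *)

Section HyperbolicityCone.

Variables (R : realType) (n k : nat) (P : {mpoly R[n]}) (e : 'rV[R]_n).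
Hypotheses (homP : P \is k.-homog) (hypP : hyperbolic P e).
Local Notation C := R[i].
Local Notation rc := (real_complex R).
Local Notation toC := (map_mx rc).
Local Notation cone := (hyp_cone k P e).

Lemma hyp_eigenvalues_eval (x : 'rV[R]_n) (lam : 'I_k -> R) (w z : C) :
  hyp_eigenvalues P e x lam ->
  evalC P (w *: toC e + z *: toC x) =
    rc P.@[e 0] * \prod_(i < k) (w + z * rc (lam i)).
Proof.
move=> hlam; have [->|z0] := eqVneq z 0.
  rewrite scale0r addr0 (evalCZ homP) evalC_real mulrC; congr (_ * _).
  under eq_bigr do rewrite mul0r addr0.
  by rewrite prodr_const card_ord.
have -> : w *: toC e + z *: toC x = z *: ((w / z) *: toC e + toC x).
  by rewrite scalerDr scalerA mulrCA divff// mulr1.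
rewrite (evalCZ homP) -evalC_line hlam map_polyZ rmorph_prod hornerZ mulrCA.
congr (_ * _); rewrite horner_prod -{1}[k]card_ord -prodr_const -big_split /=.
apply: eq_bigr => i _.
rewrite rmorphD /= map_polyX map_polyC /= !hornerE.
by rewrite mulrDr mulrCA divff// mulr1.
Qed.

Lemma meval_homogZ (s : R) (x : 'rV[R]_n) : P.@[(s *: x) 0] = s ^+ k * P.@[x 0].
Proof.
apply: (@complexI R); rewrite rmorphM rmorphXn -(evalC_real P).
by rewrite map_mxZ (evalCZ homP) evalC_real.
Qed.

(** Since all the zeros are real, membership in the cone says that none of them
    is nonnegative. *)
Lemma hyp_coneP (x : 'rV[R]_n) :
  cone x <-> forall t, 0 <= t -> P.@[(t *: e + x) 0] != 0.
Proof.
have Pe := hypP.1; split=> [[lam [hlam lam0]] t t0|nz].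
  rewrite -horner_line_poly hlam hornerZ horner_prod mulf_neq0 ?gt_eqF//.
  by apply: prodr_gt0 => i _; rewrite !hornerE ltr_wpDl.
have [lam hlam] := hyp_eigenvalues_exist x homP hypP.
exists lam; split=> // i; rewrite ltNge; apply/negP => li.
have := nz (- lam i); rewrite oppr_ge0 => /(_ li) /negP; apply.
rewrite -horner_line_poly hlam hornerZ horner_prod (bigD1 i)//= !hornerE.
by rewrite /= addNr mulr0 mul0r.
Qed.

Lemma hyp_cone_gt0 (x : 'rV[R]_n) : cone x -> 0 < P.@[x 0].
Proof.
move=> [lam [hlam lam0]]; have Pe := hypP.1.
rewrite -[x]add0r -(scale0r e) -horner_line_poly hlam hornerZ horner_prod.
by rewrite mulr_gt0// prodr_gt0// => i _; rewrite !hornerE.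
Qed.

Lemma hyp_coneZ (x : 'rV[R]_n) (s : R) : 0 < s -> cone x -> cone (s *: x).
Proof.
move=> s0 /hyp_coneP hx; apply/hyp_coneP => t t0.
have -> : t *: e + s *: x = s *: ((t / s) *: e + x).
  by rewrite scalerDr scalerA mulrCA divff ?mulr1// gt_eqF.
rewrite meval_homogZ; apply: mulf_neq0; first by rewrite expf_neq0 ?gt_eqF.
by apply: hx; rewrite divr_ge0// ltW.
Qed.

(** The cone is open in the direction [e]; this gives back the [h e] with
    [h > 0] that [stable_dir] requires. *)
Lemma hyp_cone_sub (x : 'rV[R]_n) : cone x ->
  exists2 d, 0 < d & cone (x - d *: e).
Proof.
move=> [lam [hlam lam0]].
have [d d0 hd] : exists2 d, 0 < d & forall i, d < lam i.
  exists (\big[Num.min/1]_i (lam i / 2)).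
    elim/big_ind: _ => // [u v u0 v0|i _]; first by rewrite lt_min u0.
    by rewrite divr_gt0.
  move=> i; rewrite (bigD1 i)//= gt_min.
  by apply/orP; left; have := lam0 i; lra.
exists d => //; apply/hyp_coneP => t t0.
have -> : t *: e + (x - d *: e) = (t - d) *: e + x.
  by rewrite scalerBl addrA addrAC.
rewrite -horner_line_poly hlam hornerZ horner_prod mulf_neq0//.
  by rewrite gt_eqF// hypP.1.
apply/prodf_neq0 => i _; rewrite !hornerE.
by rewrite gt_eqF//; have := hd i; lra.
Qed.

(** Asking for nonvanishing on the whole cone spanned by [e] and [a], rather
    than at [a] alone, lets [r] be deformed to [0] in [stable_dirD]. *)
Definition stable_dir (a : 'rV[R]_n) : Prop :=
  forall (v : 'rV[R]_n) (h r : R), 0 < h -> 0 <= r ->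
    evalC P (toC v + 'i%C *: toC (h *: e + r *: a)) != 0.

Lemma stable_dir0 : stable_dir 0.
Proof.
move=> v h r h0 _; rewrite scaler0 addr0 addrC map_mxZ scalerA -evalC_line.
apply/negP => /(hypP.2 v); rewrite /= => /eqP.
by rewrite mul0r mul1r add0r gt_eqF.
Qed.

(** Deform [z |-> P (v + i (h e + r a) + z y)] by replacing [v] and [r] with
    [t v] and [t r].  A real zero [z] would contradict [stable_dir a] at the
    real point [t v + z y], and for [t = 0] the zeros solve
    [i h + z lambda_j = 0].  The conclusion is the case [z = i r]. *)
Lemma stable_dirD (a y : 'rV[R]_n) : stable_dir a -> cone y -> stable_dir (a + y).
Proof.
move=> sa ylam v h r h0 r0.
pose b := toC v + 'i%C *: toC (r *: a); pose c := 'i%C *: toC (h *: e).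
pose F t (z : C) := evalC P (z *: toC y + (rc t *: b + c)).
have -> : toC v + 'i%C *: toC (h *: e + r *: (a + y)) =
    (rc r * 'i%C) *: toC y + (rc 1 *: b + c).
  by apply/rowP => j; rewrite !mxE !(rmorphD, rmorphM) /=; ring.
have y0 : evalC P (toC y) != 0.
  by rewrite evalC_real fmorph_eq0 gt_eqF// hyp_cone_gt0.
apply: (@upper_roots_homotopy R F k _ y0); last by rewrite /= mul0r mulr1 addr0.
- by move=> t; apply: (evalC_factor homP).
- exact: (evalC_lip_growth homP).
- move=> t x /andP[t0 _]; rewrite /F.
  have -> : rc x *: toC y + (rc t *: b + c) =
      toC (x *: y + t *: v) + 'i%C *: toC (h *: e + (t * r) *: a).
    by apply/rowP => j; rewrite !mxE !(rmorphD, rmorphM) /=; ring.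
  by apply: sa => //; rewrite mulr_ge0.
- move=> z z0; rewrite /F scale0r add0r /c map_mxZ scalerA addrC.
  have [lam [hlam lam0]] := ylam.
  rewrite (hyp_eigenvalues_eval _ _ hlam); apply: mulf_neq0.
    by rewrite fmorph_eq0 gt_eqF// hypP.1.
  apply/prodf_neq0 => i _; apply/eqP => /(congr1 (@complex.Im R)).
  case: z z0 => p q /= q0; rewrite mul0r mul1r add0r mulr0 add0r => /eqP.
  by rewrite gt_eqF// ltr_wpDr// mulr_ge0// ltW.
Qed.

Lemma cone_stable_dir (x : 'rV[R]_n) : cone x -> stable_dir x.
Proof. by move=> hx; rewrite -[x]add0r; apply: stable_dirD hx; apply: stable_dir0. Qed.

Lemma cone_nonvanishing (x v : 'rV[R]_n) : cone x ->
  evalC P (toC v + 'i%C *: toC x) != 0.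
Proof.
move=> /hyp_cone_sub[d d0 /cone_stable_dir sx].
by have := sx v d 1 d0 ler01; rewrite scale1r [d *: e + _]addrC subrK.
Qed.

(** With [h = d + t], the vector [h e + (x - d e) + y] is [x + y + t e]: the
    nonvanishing at its multiple by [i] is the criterion [hyp_coneP]. *)
Lemma hyp_coneD (x y : 'rV[R]_n) : cone x -> cone y -> cone (x + y).
Proof.
move=> /hyp_cone_sub[d d0 hx] hy; apply/hyp_coneP => t t0.
have td : 0 < d + t by rewrite ltr_wpDr.
have := stable_dirD (cone_stable_dir hx) hy 0 td ler01.
have -> : (d + t) *: e + 1 *: (x - d *: e + y) = t *: e + (x + y).
  by apply/rowP => i; rewrite !mxE; ring.
rewrite map_mx0 add0r (evalCZ homP) evalC_real mulf_eq0 negb_or fmorph_eq0.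
by case/andP.
Qed.

Lemma hyp_cone_convex (x y : 'rV[R]_n) (s : R) : 0 <= s <= 1 ->
  cone x -> cone y -> cone ((1 - s) *: x + s *: y).
Proof.
move=> /andP[s0 s1] hx hy.
have [->|sn0] := eqVneq s 0; first by rewrite subr0 scale1r scale0r addr0.
have [->|sn1] := eqVneq s 1; first by rewrite subrr scale0r scale1r add0r.
apply: hyp_coneD; apply: hyp_coneZ => //.
  by rewrite subr_gt0 lt_neqAle sn1.
by rewrite lt_neqAle eq_sym sn0.
Qed.

(** Every element [m] of the cone is itself a direction of hyperbolicity. *)
Lemma line_real_zeros (m d : 'rV[R]_n) (z : C) : cone m ->
  evalC P (toC m + z *: toC d) = 0 -> complex.Im z = 0.
Proof.
move=> hm; case: z => p q /= Pz; apply/eqP; apply/negPn/negP => q0.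
have q2 : 0 < q ^+ 2 by rewrite exprn_even_gt0.
(* Multiplying by [- q] times the conjugate of [z] makes the coefficient of
   [d] real and that of [m] of positive imaginary part [q ^ 2]. *)
have := cone_nonvanishing ((- (p * q)) *: m - (q * (p ^+ 2 + q ^+ 2)) *: d)
  (hyp_coneZ q2 hm).
suff -> : toC ((- (p * q)) *: m - (q * (p ^+ 2 + q ^+ 2)) *: d) +
    'i%C *: toC (q ^+ 2 *: m) =
    (- (p * q) +i* q ^+ 2)%C *: (toC m + (p +i* q)%C *: toC d).
  by rewrite (evalCZ homP) Pz mulr0 eqxx.
apply/rowP => i; rewrite !mxE; apply/eqP; rewrite eq_complex /=.
by apply/andP; split; apply/eqP; ring.
Qed.

End HyperbolicityCone.

(** * Transfers increase a symmetric hyperbolic polynomial *)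

Lemma real_rooted_split (R : realType) (p : {poly R}) : only_real_zeros p ->
  exists r : seq R, p = lead_coef p *: \prod_(w <- r) ('X - w%:P).
Proof.
move=> realp; pose rc := real_complex R.
have [p0|pn0] := eqVneq p 0.
  by exists [::]; rewrite {1}p0 p0 lead_coef0 scale0r.
have [r er] := closed_field_poly_normal (map_poly rc p).
rewrite lead_coef_map in er.
exists [seq complex.Re z | z <- r]; apply: (map_poly_inj rc).
rewrite {1}er map_polyZ rmorph_prod big_map /=; congr (_ *: _).
apply: eq_big_seq => z zr; rewrite rmorphB /= map_polyX map_polyC /=.
have : root (map_poly rc p) z.
  by rewrite er rootZ ?root_prod_XsubC// fmorph_eq0 lead_coef_eq0.
by move/realp; case: (z) => u v /= ->.
Qed.

(** For an even polynomial [q] with real zeros, the zeros of [q (- t)] are those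
    of [q t]; multiplying the two factorizations expresses [q ^ 2] through
    [w ^ 2 - t ^ 2], which decreases with [t ^ 2] as long as no zero is met. *)
Lemma even_line_increase (R : realType) (n k : nat) (P : {mpoly R[n]})
    (e m d : 'rV[R]_n) (t : R) :
  P \is k.-homog -> hyperbolic P e ->
  (forall s : R, P.@[(- s *: d + m) 0] = P.@[(s *: d + m) 0]) ->
  hyp_cone k P e (d + m) -> hyp_cone k P e (- d + m) -> -1 <= t <= 1 ->
  hyp_cone k P e (t *: d + m) /\ P.@[(d + m) 0] <= P.@[(t *: d + m) 0].
Proof.
move=> homP hypP even hp hm.
have seg s : -1 <= s <= 1 -> hyp_cone k P e (s *: d + m).
  move=> hs; have -> : s *: d + m =
      (1 - (1 - s) / 2) *: (d + m) + ((1 - s) / 2) *: (- d + m).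
    by apply/rowP => i; rewrite !mxE; field.
  by apply: (hyp_cone_convex homP hypP) => //; lra.
move=> ht; split; first exact: seg.
have hm0 : hyp_cone k P e m.
  by have := seg 0; rewrite scale0r add0r; apply; lra.
have real_q : only_real_zeros (line_poly P d m).
  move=> z /rootP; rewrite evalC_line addrC.
  exact: (line_real_zeros homP hypP).
have [r er] := real_rooted_split real_q; move: er; set c := lead_coef _ => er.
have qE s : P.@[(s *: d + m) 0] = c * \prod_(w <- r) (s - w).
  rewrite -horner_line_poly er hornerZ horner_prod; congr (_ * _).
  by apply: eq_bigr => w _; rewrite !hornerE.
have q0 s : -1 <= s <= 1 -> 0 < P.@[(s *: d + m) 0].
  by move=> /seg; apply: (hyp_cone_gt0 hypP).
have r1 w : w \in r -> 1 < w ^+ 2.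
  move=> wr; rewrite ltNge; apply/negP => w1.
  have : -1 <= w <= 1 by nra.
  by move=> /q0; rewrite qE (big_rem w)//= subrr mul0r mulr0 ltxx.
have q2 s : P.@[(s *: d + m) 0] ^+ 2 = c ^+ 2 * \prod_(w <- r) (w ^+ 2 - s ^+ 2).
  rewrite expr2 -{1}even !qE mulrACA -expr2 -big_split /=; congr (_ * _).
  by apply: eq_bigr => w _; ring.
rewrite -[d in leLHS]scale1r.
have l1 : -1 <= (1 : R) <= 1 by lra.
have [qt q1] := (ltW (q0 t ht), ltW (q0 1 l1)).
rewrite -ler_sqr ?nnegrE// !q2 ler_wpM2l ?sqr_ge0//.
rewrite big_seq [leRHS]big_seq; apply: ler_prod => w /r1 w1.
by apply/andP; split; nra.
Qed.

Section SymmetricHyperbolic.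

Variables (R : realType) (n k : nat) (P : {mpoly R[n]}).
Hypotheses (homP : P \is k.-homog) (symP : symmetric_fun P).
Hypothesis hypP : hyperbolic P (ones R n).
Local Notation cone := (hyp_cone k P (ones R n)).

Lemma hyp_cone_perm (s : 'S_n) (x : 'rV[R]_n) : cone x -> cone (col_perm s x).
Proof.
move=> /(hyp_coneP homP hypP) hx; apply/(hyp_coneP homP hypP) => t /hx.
have <- : col_perm s (t *: ones R n + x) = t *: ones R n + col_perm s x.
  by apply/rowP => i; rewrite !mxE.
by rewrite symP.
Qed.

Lemma transfer_increase (i j : 'I_n) (s : R) (x : 'rV[R]_n) :
  0 <= s <= 1 -> cone x ->
  let y := (1 - s) *: x + s *: col_perm (tperm i j) x in
  cone y /\ P.@[x 0] <= P.@[y 0].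
Proof.
move=> hs hx y; pose x' := col_perm (tperm i j) x.
pose m := 2^-1 *: (x + x'); pose d := 2^-1 *: (x - x').
have dm : d + m = x by apply/rowP => l; rewrite !mxE; field.
have dm' : - d + m = x' by apply/rowP => l; rewrite !mxE; field.
have -> : y = (1 - 2 * s) *: d + m.
  by apply/rowP => l; rewrite !mxE; field.
rewrite -{1}dm; apply: (even_line_increase homP hypP); last by lra.
- move=> t; rewrite -[RHS](symP (tperm i j)); congr (P.@[_]).
  apply: boolp.funext => l; rewrite !mxE !tpermK.
  by ring.
- by rewrite dm.
- by rewrite dm'; apply: hyp_cone_perm.
Qed.

End SymmetricHyperbolic.

(** * Doubly stochastic images as chains of transfers *)

Section Majorization.

Variables (R : realType) (n : nat) (C : 'rV[R]_n -> Prop).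
Hypothesis transferC : forall (i j : 'I_n) (s : R) (x : 'rV[R]_n),
  0 <= s <= 1 -> C x -> C ((1 - s) *: x + s *: col_perm (tperm i j) x).

(** Hardy, Littlewood and Polya.  At the first index [k] with [x_k < y_k], the
    inequality of prefix sums yields an earlier [j] with [y_j < x_j].  Move the
    smaller of the two gaps from coordinate [j] to coordinate [k]: this is a
    transfer since [y] is nonincreasing, it makes [x] and [y] agree in one more
    coordinate, and the prefix sums still dominate because [y_i <= x_i] for all
    [i < k]. *)
Lemma transfer_sorted_majorized (x y : 'rV[R]_n) :
  (forall i j : 'I_n, (i <= j)%N -> y 0 j <= y 0 i) ->
  (forall m : 'I_n, \sum_(i < n | (i <= m)%N) y 0 i <= \sum_(i < n | (i <= m)%N) x 0 i) ->
  \sum_i y 0 i = \sum_i x 0 i ->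
  C x -> C y.
Proof.
move=> sorted_y.
have [N] := ubnP #|[pred i | x 0 i != y 0 i]|; elim: N x => // N IH x cardN maj eqs Cx.
have [k0 k0P|le_yx] := pickP [pred k | x 0 k < y 0 k]; last first.
  suff -> : y = x by [].
  apply/rowP => i; apply/eqP; rewrite eq_sym -subr_eq0; apply/eqP.
  have h j : true -> 0 <= x 0 j - y 0 j.
    by move=> _; rewrite subr_ge0 leNgt; have /= -> := le_yx j.
  by apply: (psumr_eq0P h) => //; rewrite sumrB eqs subrr.
have [k xyk kmin] : exists2 k : 'I_n, x 0 k < y 0 k &
    forall i : 'I_n, (i < k)%N -> y 0 i <= x 0 i.
  case: (@arg_minnP _ k0 [pred k | x 0 k < y 0 k] (@nat_of_ord n)) => // k xyk kmin.
  exists k => // i ik; rewrite leNgt; apply/negP => /kmin.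
  by rewrite leqNgt ik.
have [j /andP[jk yxj]|no_j] := pickP [pred j : 'I_n | (j < k)%N && (y 0 j < x 0 j)]; last first.
  have := maj k; rewrite leNgt => /negP[].
  rewrite (bigD1 k)//= [ltRHS](bigD1 k)//= ltr_leD//.
  apply: ler_sum => i /andP[ik nik]; rewrite leNgt; apply/negP => yxi.
  by have := no_j i; rewrite /= yxi ltn_neqAle nik ik.
have kj : k != j by apply: contraTneq jk => ->; rewrite ltnn.
pose h := Num.min (x 0 j - y 0 j) (y 0 k - x 0 k).
have h0 : 0 < h by rewrite lt_min !subr_gt0 yxj.
have hj : h <= x 0 j - y 0 j by rewrite ge_min lexx.
have hk : h <= y 0 k - x 0 k by rewrite ge_min lexx orbT.
have ykj := sorted_y j k (ltnW jk).
have gap : 0 < x 0 j - x 0 k by lra.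
pose s := h / (x 0 j - x 0 k).
have hs : 0 <= s <= 1.
  apply/andP; split; first by rewrite divr_ge0// ltW.
  by rewrite ler_pdivrMr// mul1r; lra.
have sgap : s * (x 0 j - x 0 k) = h by rewrite divfK// gt_eqF.
pose x' := (1 - s) *: x + s *: col_perm (tperm j k) x.
have x'E i : x' 0 i = x 0 i + (if i == k then h else 0) - (if i == j then h else 0).
  rewrite !mxE; case: tpermP => [->|->|/eqP/negPf nj /eqP/negPf nk].
  - by rewrite eqxx eq_sym (negPf kj) -sgap; ring.
  - by rewrite eqxx (negPf kj) -sgap; ring.
  - by rewrite nj nk; ring.
have sum_at (Q : pred 'I_n) l : \sum_(i < n | Q i) (if i == l then h else 0) =
    if Q l then h else 0.
  rewrite -big_mkcondr /=; case: ifP => Ql.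
    by rewrite (big_pred1 l)// => i /=; case: eqVneq => [->|_]; rewrite ?Ql ?andbF.
  by rewrite big_pred0// => i /=; case: eqVneq => [->|_]; rewrite ?Ql ?andbF.
apply: (IH x'); last exact: transferC.
- move: cardN; rewrite ltnS; apply: leq_trans; apply: proper_card; apply/properP; split.
    apply/fintype.subsetP => i; rewrite !inE x'E; apply: contraNneq => xyi.
    have [ik|_] := eqVneq i k; first by move: xyk; rewrite -ik xyi ltxx.
    have [ij|_] := eqVneq i j; first by move: yxj; rewrite -ij xyi ltxx.
    by rewrite addr0 subr0 xyi.
  have [hE|hE] : h = x 0 j - y 0 j \/ h = y 0 k - x 0 k.
    by rewrite /h; case: leP; [left|right].
  + exists j; rewrite !inE ?(gt_eqF yxj)// x'E eqxx [j == k]eq_sym (negPf kj) negbK.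
    by apply/eqP; lra.
  + exists k; rewrite !inE ?(lt_eqF xyk)// x'E eqxx (negPf kj) negbK.
    by apply/eqP; lra.
- move=> m; under [leRHS]eq_bigr do rewrite x'E.
  rewrite sumrB big_split /= !sum_at.
  have [km|mk] := leqP k m.
    by rewrite (leq_trans (ltnW jk) km) addrK.
  rewrite addr0; have [jm|mj] := leqP j m; last by rewrite subr0.
  rewrite (bigD1 j)//= [X in _ <= X - h](bigD1 j)//=.
  have : \sum_(i < n | (i <= m)%N && (i != j)) y 0 i <=
         \sum_(i < n | (i <= m)%N && (i != j)) x 0 i.
    by apply: ler_sum => i /andP[im _]; apply: kmin; apply: leq_ltn_trans mk.
  by lra.
- rewrite eqs; under [RHS]eq_bigr do rewrite x'E.
  by rewrite sumrB big_split /= !sum_at addrK.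
Qed.

Lemma exists_sorting_perm (x : 'rV[R]_n) :
  exists s : 'S_n, forall i j : 'I_n, (i <= j)%N -> x 0 (s j) <= x 0 (s i).
Proof.
pose le_x (i j : 'I_n) := x 0 j <= x 0 i.
have szt : size (sort le_x (enum 'I_n)) == n by rewrite size_sort size_enum_ord.
pose t := Tuple szt.
have inj_t : injective (tnth t).
  by apply/tuple_uniqP; rewrite /= sort_uniq enum_uniq.
exists (perm inj_t) => i j ij; rewrite !permE !(tnth_nth i) /=.
have tr : transitive le_x by move=> b a c; rewrite /le_x => h1 h2; apply: le_trans h1.
have srt : sorted le_x (sort le_x (enum 'I_n)).
  by apply: sort_sorted => a b; rewrite /le_x le_total.
apply: (sorted_leq_nth tr _ i srt) => //; rewrite ?inE ?(eqP szt)//.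
by move=> a; rewrite /le_x.
Qed.

Hypothesis permC : forall (s : 'S_n) (x : 'rV[R]_n), C x -> C (col_perm s x).

(** With both vectors sorted, a prefix sum of [S x] is [sum c_j x_j] with
    weights [0 <= c_j <= 1] of total [m + 1]; it is largest when the weight sits
    on the [m + 1] largest coordinates of [x]. *)
Lemma transfer_doubly_stochastic (S : 'I_n -> 'I_n -> R) (x : 'rV[R]_n) :
  (forall i j, 0 <= S i j) -> (forall i, \sum_j S i j = 1) ->
  (forall j, \sum_i S i j = 1) ->
  C x -> C (\row_i \sum_j S i j * x 0 j).
Proof.
move=> S0 rowS colS Cx; set y := \row_i _.
have [s sorted_y] := exists_sorting_perm y.
have [t sorted_x] := exists_sorting_perm x.
have -> : y = col_perm s^-1 (col_perm s y).
  by apply/rowP => i; rewrite !mxE permKV.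
apply: permC; apply: (transfer_sorted_majorized _ _ _ (permC t Cx)).
- by move=> i j ij; rewrite !mxE; have := sorted_y i j ij; rewrite !mxE.
- move=> m; pose c j := \sum_(i < n | (i <= m)%N) S (s i) (t j).
  have c0 j : 0 <= c j by apply: sumr_ge0.
  have c1 j : c j <= 1.
    rewrite -(colS (t j)) (reindex_inj (@perm_inj _ s)) /= /c.
    by rewrite [leRHS](bigID (fun i : 'I_n => (i <= m)%N)) /= lerDl sumr_ge0.
  have -> : \sum_(i < n | (i <= m)%N) (col_perm s y) 0 i = \sum_j c j * x 0 (t j).
    under eq_bigr do rewrite !mxE (reindex_inj (@perm_inj _ t)) /=.
    by rewrite exchange_big /=; apply: eq_bigr => j _; rewrite -mulr_suml.
  have -> : \sum_(i < n | (i <= m)%N) (col_perm t x) 0 i =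
      \sum_(j < n) (j <= m)%N%:R * x 0 (t j).
    by rewrite big_mkcond /=; apply: eq_bigr => j _; rewrite !mxE;
       case: ifP => _; rewrite ?mul1r ?mul0r.
  have sumc : \sum_j c j = \sum_(j < n) (j <= m)%N%:R.
    rewrite exchange_big [LHS]big_mkcond /=; apply: eq_bigr => i _.
    by have := rowS (s i); rewrite (reindex_inj (@perm_inj _ t)) /= => ->; case: ifP.
  (* As both weights have the same total, [x] may be shifted by its value at
     the threshold [m], after which every term is nonnegative. *)
  rewrite -subr_ge0 -sumrB.
  have -> : \sum_(j < n) ((j <= m)%N%:R * x 0 (t j) - c j * x 0 (t j)) =
      \sum_(j < n) ((j <= m)%N%:R - c j) * (x 0 (t j) - x 0 (t m)).
    under [RHS]eq_bigr do rewrite mulrBr.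
    rewrite [RHS]sumrB -mulr_suml [in X in _ - X]sumrB sumc subrr mul0r subr0.
    by apply: eq_bigr => j _; rewrite mulrBl.
  apply: sumr_ge0 => j _; have [jm|mj] := leqP j m.
    by rewrite mulr_ge0// subr_ge0 ?c1 ?sorted_x.
  by rewrite mulr_le0// ?sub0r ?oppr_le0// subr_le0 sorted_x// ltnW.
- have perm_sum (u : 'S_n) (z : 'rV[R]_n) : \sum_i (col_perm u z) 0 i = \sum_i z 0 i.
    by rewrite [RHS](reindex_inj (@perm_inj _ u)); apply: eq_bigr => i _; rewrite mxE.
  rewrite !perm_sum; under eq_bigr do rewrite mxE.
  by rewrite exchange_big; apply: eq_bigr => j _; rewrite -mulr_suml colS mul1r.
Qed.

End Majorization.

(** * Eigenvalues of the diagonal blocks of a Hermitian matrix *)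

Section BlockEigenvalues.

Variable R : realType.
Local Open Scope sesquilinear_scope.

(** The weights are the squared moduli of the entries of [W]; their row and
    column sums are the diagonal entries of [W W^*] and [W^* W]. *)
Lemma unitary_diag_average (n : nat) (W : 'M[R[i]]_n) (d : 'rV[R]_n) :
  W \is unitarymx ->
  exists S : 'I_n -> 'I_n -> R,
    [/\ forall i j, 0 <= S i j, forall i, \sum_j S i j = 1,
        forall j, \sum_i S i j = 1 &
        forall i, (W *m diag_mx (map_mx (real_complex R) d) *m W^t*) i i =
          real_complex R (\sum_j S i j * d 0 j)].
Proof.
move=> uW; exists (fun i j => normc (W i j) ^+ 2).
have sq i j : real_complex R (normc (W i j) ^+ 2) = W i j * Num.conj (W i j).
  by rewrite -normCK rmorphXn.
split=> [i j|i|j|i].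
- exact: sqr_ge0.
- apply: (@complexI R); rewrite rmorph_sum rmorph1 /=.
  under eq_bigr do rewrite sq.
  transitivity ((W *m W^t* ) i i); last by rewrite (unitarymxP uW) mxE eqxx.
  by rewrite mxE; apply: eq_bigr => j _; rewrite !mxE.
- apply: (@complexI R); rewrite rmorph_sum rmorph1 /=.
  under eq_bigr do rewrite sq.
  transitivity ((W^t* *m W) j j).
    by rewrite mxE; apply: eq_bigr => i _; rewrite !mxE mulrC.
  by rewrite -invmx_unitary// mulVmx ?unitarymx_unit// mxE eqxx.
- rewrite rmorph_sum mul_mx_diag mxE; apply: eq_bigr => j _.
  by rewrite rmorphM /= sq !mxE mulrAC.
Qed.

Lemma hermitian_spectral_decomp (n : nat) (M : 'M[R[i]]_n) :
  M \is hermsymmx ->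
  M = (spectralmx M)^t* *m diag_mx (map_mx (real_complex R) (eigvals M)) *m spectralmx M.
Proof.
move=> hM; have -> : map_mx (real_complex R) (eigvals M) = spectral_diag M.
  have /mxOverP realD := hermitian_spectral_diag_real hM.
  by apply/rowP => i; rewrite !mxE RRe_real.
rewrite -invmx_unitary ?spectral_unitarymx//.
by apply/orthomx_spectralP; apply: hermitian_normalmx.
Qed.

(** The block-diagonal unitary [V] diagonalizes both diagonal blocks, so [mu] is
    the diagonal of [V A V^*], and [V A V^*] is unitarily equivalent to the
    diagonal matrix of the eigenvalues of [A]. *)
Lemma block_eigvals_doubly_stochastic (n1 n2 : nat) (A : 'M[R[i]]_(n1 + n2)) :
  A \is hermsymmx ->
  let mu := row_mx (eigvals (ulsubmx A)) (eigvals (drsubmx A)) in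
  exists S : 'I_(n1 + n2) -> 'I_(n1 + n2) -> R,
    [/\ forall i j, 0 <= S i j, forall i, \sum_j S i j = 1,
        forall j, \sum_i S i j = 1 &
        mu = \row_i \sum_j S i j * eigvals A 0 j].
Proof.
move=> hA mu.
have hermE m (M : 'M[R[i]]_m) : (M \is hermsymmx) = (M == M^t*).
  by rewrite is_hermitianmxE expr0 scale1r.
have [h1 h2] : ulsubmx A \is hermsymmx /\ drsubmx A \is hermsymmx.
  move: hA; rewrite !hermE => /eqP eA.
  by split; apply/eqP; rewrite {1}eA; apply/matrixP => i j; rewrite !mxE.
pose U1 := spectralmx (ulsubmx A); pose U2 := spectralmx (drsubmx A).
have u1 : U1 \is unitarymx by apply: spectral_unitarymx.
have u2 : U2 \is unitarymx by apply: spectral_unitarymx.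
pose V := block_mx U1 0 0 U2.
have Vt : V^t* = block_mx (U1^t*) 0 0 (U2^t*).
  by rewrite /V tr_block_mx map_block_mx !trmx0 !map_mx0.
have uV : V \is unitarymx.
  apply/unitarymxP; rewrite Vt mulmx_block !mulmx0 !mul0mx !addr0 !add0r.
  by rewrite (unitarymxP u1) (unitarymxP u2) -scalar_mx_block.
pose W := V *m (spectralmx A)^t*.
have uW : W \is unitarymx.
  by rewrite mul_unitarymx ?trmxC_unitary ?spectral_unitarymx.
have [S [S0 rowS colS dS]] := unitary_diag_average (eigvals A) uW.
exists S; split=> //; apply/rowP => i; rewrite [RHS]mxE; apply: (@complexI R).
rewrite -dS.
have -> : W *m diag_mx (map_mx (real_complex R) (eigvals A)) *m W^t* = V *m A *m V^t*.
  rewrite [A in RHS](hermitian_spectral_decomp hA) /W trmx_mul map_mxM.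
  rewrite -/(_ ^t*) trmxCK !mulmxA //.
have diag1 m (M : 'M[R[i]]_m) : M \is hermsymmx ->
    spectralmx M *m M *m (spectralmx M)^t* = diag_mx (map_mx (real_complex R) (eigvals M)).
  move=> hM; rewrite {2}(hermitian_spectral_decomp hM) !mulmxA.
  rewrite (unitarymxP (spectral_unitarymx M)) mul1mx -mulmxA.
  by rewrite (unitarymxP (spectral_unitarymx M)) mulmx1.
rewrite Vt -[A]submxK !mulmx_block !mul0mx !mulmx0 !addr0 !add0r.
rewrite !diag1//.
case: (split_ordP i) => l ->.
  by rewrite block_mxEul row_mxEl !mxE eqxx.
by rewrite block_mxEdr row_mxEr !mxE eqxx.
Qed.

End BlockEigenvalues.

Theorem corollary3p7 (R : realType) (n1 n2 k : nat)
    (P : {mpoly R[n1 + n2]}) (A : 'M[R[i]]_(n1 + n2)) :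
  P \is k.-homog ->
  symmetric_fun P ->
  hyperbolic P (ones R (n1 + n2)) ->
  A \is hermsymmx ->
  hyp_cone k P (ones R (n1 + n2)) (eigvals A) ->
  let mu := row_mx (eigvals (ulsubmx A)) (eigvals (drsubmx A)) in
  hyp_cone k P (ones R (n1 + n2)) mu /\
  P.@[(eigvals A) 0] <= P.@[mu 0].
Proof.
move=> homP symP hypP hA coneA mu.
have [S [S0 rowS colS muE]] := block_eigvals_doubly_stochastic hA.
pose C x := hyp_cone k P (ones R (n1 + n2)) x /\ P.@[(eigvals A) 0] <= P.@[x 0].
suff : C mu by [].
rewrite /mu muE; apply: (transfer_doubly_stochastic _ _ S0 rowS colS).
- move=> i j s x hs [cx lx].
  have [cy ly] := transfer_increase homP symP hypP i j hs cx.
  by split=> //; apply: le_trans ly.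
- move=> s x [cx lx]; split; first exact: (hyp_cone_perm homP symP hypP).
  by rewrite symP.
- by split.
Qed.
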